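(* Let $\mathcal X\in\mathbb R^{n_1\times n_2\times n_3}$, $r\le\min(n_1,n_2)$, and let $\mathcal V\in\mathbb R^{n_2\times r\times n_3}$ satisfy $\mathcal V^\top*\mathcal V=\mathcal I_r$. Let $J$ be obtained by applying T-ARP to $\mathcal V$, set $\mathcal C=\mathcal X(:,J,:)$, and let $\mathcal C=\mathcal Q_J*\mathcal R_J$ be a thin T-QR factorization with $\mathcal Q_J\in\mathbb R^{n_1\times r\times n_3}$, $\mathcal Q_J^\top*\mathcal Q_J=\mathcal I_r$. Apply T-ARP to $\mathcal Q_J$ to obtain $I$. Assume that $\mathcal X(I,J,:)$ is t-invertible almost surely. Assume that the first T-ARP call satisfies the frequency alignment and rank growth assumption (stated in the context) for $\mathcal V$ with constants $\eta_1,\dots,\eta_r\ge1$, and that, conditionally on every $J$ in the support of the first call, the second T-ARP call satisfies the same assumption for $\mathcal Q_J$ with deterministic constants $\theta_1,\dots,\theta_r\ge1$ not depending on $J$. Put $$\Gamma_\eta=\prod_{k=1}^r\left(1+\frac{\eta_k}{r-k+1}\right),\qquad \Gamma_\theta=\prod_{k=1}^r\left(1+\frac{\theta_k}{r-k+1}\right).$$ Then $$\mathbb E\left\|\mathcal X-\mathcal X(:,J,:)*\mathcal X(I,J,:)^{-1}*\mathcal X(I,:,:)\right\|_F^2\le\Gamma_\theta\Gamma_\eta\|\mathcal X-\mathcal X*\mathcal V*\mathcal V^\top\|_F^2 .$$ If both calls are perfectly aligned (at every step, so that $\eta_k=\theta_k=1$ for all $k$), the factor $\Gamma_\theta\Gamma_\eta$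 equals $(r+1)^2$.
   Context: T-product conventions (with $p=n_3$). For a tensor $\mathcal A$ with $p$ frontal slices $A^{(k)}$, its Fourier slices are $\widehat A^{(\ell)}=\sum_{k=1}^p e^{-2\pi i(\ell-1)(k-1)/p}A^{(k)}$, $\ell=1,\dots,p$. The t-product $\mathcal A*\mathcal B$ is the tensor with Fourier slices $\widehat A^{(\ell)}\widehat B^{(\ell)}$. For real $\mathcal A$, $\mathcal A^\top$ is the real tensor with Fourier slices $(\widehat A^{(\ell)})^H$. The identity tensor $\mathcal I_n$ has first frontal slice $I_n$ and all others zero. Inverses (t-invertibility) and Moore–Penrose pseudoinverses under the t-product are taken slicewise in the Fourier domain. $\|\cdot\|_F$ is the Frobenius norm. For an index tuple $J=(j_1,\dots,j_k)$, $E_J=[e_{j_1},\dots,e_{j_k}]\in\mathbb R^{n\times k}$. Thin T-QR: $\mathcal C=\mathcal Q*\mathcal R$ with $\mathcal Q\in\mathbb R^{n_1\times r\times n_3}$, $\mathcal Q^\top*\mathcal Q=\mathcal I_r$, and $\mathcal R\in\mathbb R^{r\times r\times n_3}$ with every frontal slice upper triangular. T-ARP. Input: $\mathcal V\in\mathbb R^{n\times r\times p}$ with $\mathcal V^\top*\mathcal V=\mathcal I_r$. Set $J_0=()$, $\mathcal W^{(0)}=\mathcal V$. For $k=1,\dots,r$: conditionally on $J_{k-1}$, sample $j_k\in\{1,\dots,n\}$ with probability of $j$ equal to $\|\mathcal W^{(k-1)}(j,:,:)\|_F^2/\|\mathcal W^{(k-1)}\|_F^2$; set $J_k=(J_{k-1},j_k)$,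 $\mathcal Z_k=\mathcal W^{(k-1)}(j_k,:,:)$ and $\mathcal W^{(k)}=\mathcal W^{(k-1)}*(\mathcal I_r-\mathcal Z_k^\dagger*\mathcal Z_k)$. Output: $J=J_r$. Write $\widehat W^{(k,\ell)}$ for the $\ell$-th Fourier slice of $\mathcal W^{(k)}$. The second call uses fresh randomness, conditionally on $J$. Sampling quantities. For a history $J_{k-1}$ of positive probability, put $a_{j,k}^{(\ell)}=\|\widehat W^{(k-1,\ell)}(j,:)\|_2^2$, $$q_{j,k}=\frac{\sum_{\nu=1}^p a_{j,k}^{(\nu)}}{\sum_{i=1}^n\sum_{\nu=1}^p a_{i,k}^{(\nu)}},\qquad p_{j,k}^{(\ell)}=\frac{a_{j,k}^{(\ell)}}{\sum_{i=1}^n a_{i,k}^{(\ell)}}.$$ Frequency alignment and rank growth assumption (for an input basis $\mathcal V$, with constants $\eta_k\ge1$, $k=1,\dots,r$): (i) for every $k=1,\dots,r$, every history $J_{k-1}$ of positive probability, every frequency $\ell$, and every index $j$ with $a_{j,k}^{(\ell)}>0$, one has $q_{j,k}\le\eta_k p_{j,k}^{(\ell)}$; (ii) for every $k=0,1,\dots,r$, every history $J_k$ of positive probability and every frequency $\ell$, $\operatorname{rank}(E_{J_k}^H\widehat V^{(\ell)})=k$. For the second call the same definitions are used with $\mathcal Q_J$ in place of $\mathcal V$, $n_1$ in place of $n$, and $\theta_k$ in place of $\eta_k$. The distributions are perfectly aligned at step $k$ when $q_{j,k}=p_{j,k}^{(\ell)}$ for all $j,\ell$ (for every history of positive probability); this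 corresponds to the constant at step $k$ being $1$. *)

(* Defs.v *)
From mathcomp Require Import all_boot all_order all_algebra.
From mathcomp Require Import complex.
From mathcomp Require Import boolp classical_sets reals topology normedtype trigo.

Set Implicit Arguments.
Unset Strict Implicit.
Unset Printing Implicit Defensive.

Import Order.TTheory GRing.Theory Num.Theory.

Local Open Scope ring_scope.
Local Open Scope complex_scope.
Local Open Scope sesquilinear_scope.

(* m x n x p tensors, as the family of their p frontal slices (indexed from 0). *)
Notation tensor R m n p := {ffun 'I_p -> 'M[R]_(m, n)}.

Section Fourier.
Variable R : realType.

(* e^(i x) *)
Definition expi (x : R) : R[i] := cos x +i* sin x.

Definition fourier m n p (A : tensor R m n p) (l : 'I_p) : 'M[R[i]]_(m, n) :=
  \sum_(k < p) expi (- (2 * pi * (l * k)%:R / p%:R)) *: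
    map_mx (real_complex R) (A k).

(* The real tensor with prescribed Fourier slices, by the inverse transform.
   Every family F used below is conjugate-symmetric (F_(-l) = conj F_l), so that
   the inverse transform is already real and Re discards nothing: see
   [of_fourierK], [fourier_tprod], [fourier_ttr], [fourier_tinv] and
   [fourier_tpinv]. *)
Definition of_fourier m n p (F : 'I_p -> 'M[R[i]]_(m, n)) : tensor R m n p :=
  [ffun k : 'I_p => map_mx (@complex.Re R)
     ((p%:R)^-1 *: \sum_(l < p) expi (2 * pi * (l * k)%:R / p%:R) *: F l)].

Implicit Types x : R.

Lemma expi0 : expi 0 = 1 :> R[i].
Proof. by rewrite /expi cos0 sin0. Qed.

Lemma expiD x y : expi (x + y) = expi x * expi y.
Proof.
by rewrite /expi cosD sinD; apply/eqP; rewrite eq_complex /= eqxx addrC eqxx.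
Qed.

Lemma expiMn x k : expi (x *+ k) = expi x ^+ k.
Proof.
by elim: k => [|k IH]; rewrite ?mulr0n ?expi0 // mulrS expiD IH exprS.
Qed.

Lemma expiN x : expi (- x) = (expi x)^-1.
Proof.
have h : expi x * expi (- x) = 1 by rewrite -expiD subrr expi0.
have nz : expi x != 0.
  by apply/eqP => e; move: h; rewrite e mul0r => /eqP; rewrite eq_sym oner_eq0.
by apply: (mulfI nz); rewrite h divff.
Qed.

Lemma expi_conj x : Num.conj (expi x) = expi (- x).
Proof. by rewrite /expi cosN sinN. Qed.

Lemma expi_prim p : (0 < p)%N -> p.-primitive_root (expi (2 * pi / p%:R) : R[i]).
Proof.
move=> p0; have pn : (p%:R != 0 :> R) by rewrite pnatr_eq0 -lt0n.
apply/andP; split => //; apply/forallP => i.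
rewrite unity_rootE -expiMn -(mulr_natr (_ / _)).
case: (eqVneq i.+1 p) => [->|ip].
  by rewrite divfK // /expi mulr_natl cos2pi sin2pi !eqxx.
rewrite eqbF_neg; apply/eqP => h.
have lt : (i.+1 < p)%N by rewrite ltn_neqAle ip ltn_ord.
set y := pi * i.+1%:R / p%:R : R.
have e : 2 * pi / p%:R * i.+1%:R = y *+ 2.
  by rewrite -[RHS]mulr_natl /y !mulrA (mulrAC _ _ i.+1%:R).
move: h; rewrite e /expi => -[] + _; rewrite cos_mulr2n.
have sy : 0 < sin y.
  apply: sin_gt0_pi; apply/andP; split.
    by rewrite /y divr_gt0 ?mulr_gt0 ?pi_gt0 ?ltr0n.
  by rewrite /y -mulrA gtr_pMr ?pi_gt0 // ltr_pdivrMr ?ltr0n // mul1r ltr_nat.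
move/eqP; rewrite subr_eq -[1 + 1]/(1 *+ 2) eqrMn2r //= => /eqP c1.
have := cos2Dsin2 y; rewrite c1 => /eqP.
by rewrite -subr_eq0 addrAC subrr add0r expf_eq0 /= gt_eqF.
Qed.

Lemma expi_orth p (l m : 'I_p) :
  \sum_(k < p) expi (- (2 * pi * (l * k)%:R / p%:R)) *
    expi (2 * pi * (m * k)%:R / p%:R) = (p%:R *+ (l == m) : R[i]).
Proof.
have p0 : (0 < p)%N by case: p l {m} => [[]|].
have pw := expi_prim p0; set w := expi _ in pw.
have E (a k : nat) : expi (2 * pi * (a * k)%:R / p%:R) = (w ^+ a) ^+ k.
  by rewrite -exprM -expiMn [2 * pi * _ / _]mulrAC mulr_natr.
pose z := w ^+ m / w ^+ l.
have w0 : w != 0 by rewrite (prim_root_eq0 pw) -lt0n.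
rewrite (eq_bigr (fun k : 'I_p => z ^+ k)) => [|k _]; last first.
  by rewrite expiN !E exprMn exprVn mulrC.
case: eqVneq => [e|lm].
  rewrite /z e divff ?expf_neq0 // (eq_bigr (fun=> 1)) => [|k _].
    by rewrite sumr_const card_ord.
  by rewrite expr1n.
have z1 : z - 1 != 0.
  rewrite subr_eq0; apply: contra lm => /eqP e.
  have : w ^+ m == w ^+ l by rewrite -(divfK (expf_neq0 l w0) (w ^+ m)) -/z e mul1r.
  by rewrite (eq_prim_root_expr pw) !modn_small // eq_sym.
apply: (mulfI z1); rewrite -subrX1 mulr0n mulr0.
rewrite exprMn exprVn -!exprM ![(_ * p)%N]mulnC !exprM.
by rewrite (prim_expr_order pw) !expr1n divr1 subrr.
Qed.

Definition conj_sym m n p (F : 'I_p -> 'M[R[i]]_(m, n)) :=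
  forall l l' : 'I_p, (p %| l + l')%N -> F l' = map_mx Num.conj (F l).

Lemma expiN_sym p (l l' k : 'I_p) : (p %| l + l')%N ->
  expi (- (2 * pi * (l * k)%:R / p%:R)) = expi (2 * pi * (l' * k)%:R / p%:R) :> R[i].
Proof.
move=> d; have p0 : (0 < p)%N by case: p l {l' k d} => [[]|].
have pw := expi_prim p0; set w := expi _ in pw.
have w0 : w != 0 by rewrite (prim_root_eq0 pw) -lt0n.
have E (a : nat) : expi (2 * pi * (a * k)%:R / p%:R) = (w ^+ a) ^+ k.
  by rewrite -exprM -expiMn [2 * pi * _ / _]mulrAC mulr_natr.
rewrite expiN !E -exprVn; congr (_ ^+ _).
apply: (mulfI (expf_neq0 l w0)); rewrite divff ?expf_neq0 // -exprD.
by case/dvdnP: d => q ->; rewrite mulnC exprM (prim_expr_order pw) expr1n.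
Qed.

Lemma fourier_conj m n p (A : tensor R m n p) : conj_sym (fourier A).
Proof.
move=> l l' d; rewrite /fourier raddf_sum /=; apply: eq_bigr => k _.
rewrite map_mxZ /= expi_conj opprK (@expiN_sym p l' l k) 1?addnC //.
congr (_ *: _); apply/matrixP => i j; rewrite !mxE.
by apply/eqP; rewrite eq_complex /= oppr0 !eqxx.
Qed.

Lemma re_mxK m n (M : 'M[R[i]]_(m, n)) : map_mx Num.conj M = M ->
  map_mx (real_complex R) (map_mx (@complex.Re R) M) = M.
Proof.
move=> h; apply/matrixP => i j; rewrite !mxE.
have := congr1 (fun M : 'M_(m, n) => M i j) h; rewrite mxE.
case: (M i j) => a b [] /eqP; rewrite -subr_eq0 -opprD oppr_eq0 -mulr2n.
by rewrite mulrn_eq0 /= => /eqP ->.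
Qed.

Lemma of_fourierK m n p (F : 'I_p -> 'M[R[i]]_(m, n)) l :
  conj_sym F -> fourier (of_fourier F) l = F l.
Proof.
move=> Fs; have p0 : (0 < p)%N by case: p l {F Fs} => [[]|].
have pn : (p%:R != 0 :> R[i]) by rewrite pnatr_eq0 -lt0n.
have [N [NK N1]] : exists N : 'I_p -> 'I_p, involutive N /\
    forall l : 'I_p, (p %| l + N l)%N.
  case: p l F Fs p0 {pn} => [[]//|p] _ _ _ _; exists (fun l => (- l)%R).
  split; first exact: opprK.
  by move=> l /=; rewrite /dvdn modnDmr subnKC ?modnn // ltnW.
pose G (k : 'I_p) := (p%:R)^-1 *: \sum_(l < p) expi (2 * pi * (l * k)%:R / p%:R) *: F l.
have conjE (z : R[i]) : Num.conj z = z^*%C by [].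
have Gr k : map_mx (real_complex R) (map_mx (@complex.Re R) (G k)) = G k.
  have h : map_mx Num.conj (G k) = G k.
    rewrite /G map_mxZ fmorphV rmorph_nat; congr (_ *: _).
    rewrite raddf_sum (reindex_inj (inv_inj NK)) /=; apply: eq_bigr => a _.
    rewrite map_mxZ /= expi_conj; congr (_ *: _).
      by rewrite (@expiN_sym p (N a) a k) // addnC.
    by rewrite (Fs _ _ (N1 a)); apply/matrixP => i j; rewrite !mxE conjCK.
  exact: re_mxK.
rewrite /fourier.
rewrite (eq_bigr (fun k : 'I_p =>
  expi (- (2 * pi * (l * k)%:R / p%:R)) *: G k)); last first.
  by move=> k _; rewrite ffunE Gr.
rewrite /G.
under eq_bigr do rewrite scalerA mulrC -scalerA scaler_sumr.
rewrite -scaler_sumr exchange_big /=.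
rewrite (eq_bigr (fun a => (p%:R *+ (l == a) : R[i]) *: F a)); last first.
  move=> a _; rewrite -expi_orth scaler_suml.
  by apply: eq_bigr => k _; rewrite scalerA.
rewrite (bigD1 l) //= eqxx big1 ?addr0 => [|a la]; last first.
  by rewrite eq_sym (negPf la) scale0r.
by rewrite scalerA mulVf ?scale1r.
Qed.

End Fourier.

Section MoorePenrose.
Variable C : numClosedFieldType.

Definition penrose m n (A : 'M[C]_(m, n)) (B : 'M[C]_(n, m)) : Prop :=
  [/\ A *m B *m A = A, B *m A *m B = B,
      (A *m B) ^t* = A *m B & (B *m A) ^t* = B *m A].

Definition mp_inv m n (A : 'M[C]_(m, n)) : 'M[C]_(n, m) :=
  xget 0 [set B | penrose A B].

Lemma penrose_uniq m n (A : 'M[C]_(m, n)) B B' :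
  penrose A B -> penrose A B' -> B = B'.
Proof.
move=> [a1 b1 c1 d1] [a2 b2 c2 d2].
have e1 : A *m B = A *m B'.
  have h : A *m B = (A *m B') *m (A *m B) by rewrite mulmxA a2.
  by rewrite h -c2 -c1 -map_mxM -trmx_mul mulmxA a1.
have e2 : B *m A = B' *m A.
  have h : B *m A = (B *m A) *m (B' *m A) by rewrite -mulmxA (mulmxA A) a2.
  by rewrite h -d2 -d1 -map_mxM -trmx_mul -mulmxA (mulmxA A) a1.
by rewrite -b1 e2 -mulmxA e1 mulmxA b2.
Qed.

Lemma gram_unit m n (A : 'M[C]_(m, n)) : row_free A -> A *m A ^t* \in unitmx.
Proof.
move=> fA; rewrite -row_free_unit -kermx_eq0 -submx0; apply/rV_subP => u.
move/sub_kermxP; rewrite mulmxA => h; suff -> : u = 0 by apply: sub0mx.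
apply: (row_free_inj fA); rewrite mul0mx; apply/eqP.
have h0 : (u *m A) *m (u *m A) ^t* = 0.
  by rewrite trmx_mul map_mxM mulmxA h mul0mx.
apply/eqP/rowP => i; rewrite [RHS]mxE; apply/eqP.
have /eqP := congr1 (fun M : 'M_1 => M 0 0) h0; rewrite !mxE.
rewrite psumr_eq0 => [|k _]; last by rewrite !mxE mul_conjC_ge0.
by move/allP/(_ i (mem_index_enum _)); rewrite !mxE mul_conjC_eq0.
Qed.

Lemma penrose_full_rank m n k (c : 'M[C]_(m, k)) (d : 'M[C]_(k, n)) :
  row_free (c ^t*) -> row_free d -> exists B, penrose (c *m d) B.
Proof.
move=> /gram_unit; rewrite trmxCK => uc /gram_unit ud.
pose G := invmx (d *m d ^t*); pose H := invmx (c ^t* *m c).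
have VH : H *m (c ^t* *m c) = 1%:M by apply: mulVmx.
have VG : (d *m d ^t*) *m G = 1%:M by apply: mulmxV.
have hG : G ^t* = G.
  by rewrite /G trmx_inv map_invmx trmx_mul map_mxM trmxCK.
have hH : H ^t* = H.
  by rewrite /H trmx_inv map_invmx trmx_mul map_mxM trmxCK.
pose B := d ^t* *m G *m H *m c ^t*.
have AB : c *m d *m B = c *m H *m c ^t*.
  by rewrite /B !mulmxA -(mulmxA c) -(mulmxA c) VG mulmx1.
have BA : B *m (c *m d) = d ^t* *m G *m d.
  by rewrite /B !mulmxA -(mulmxA (_ *m H)) -(mulmxA (_ *m G) H) VH mulmx1.
exists B; split.
- by rewrite AB !mulmxA -(mulmxA (_ *m H)) -(mulmxA c) VH mulmx1.
- by rewrite BA /B !mulmxA -(mulmxA (_ *m G) d) -(mulmxA _ (d *m _) G) VG mulmx1.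
- by rewrite AB !(trmx_mul, map_mxM) hH trmxCK mulmxA.
- by rewrite BA !(trmx_mul, map_mxM) hG trmxCK mulmxA.
Qed.

Lemma penrose_mp_inv m n (A : 'M[C]_(m, n)) : penrose A (mp_inv A).
Proof.
rewrite /mp_inv; apply: (@xgetPex _ 0 [set B | penrose A B]%classic).
rewrite -[X in penrose X](mulmx_base A); apply: penrose_full_rank (row_base_free A).
by rewrite row_free_map /row_free mxrank_tr; apply: col_base_full.
Qed.

Lemma mp_inv_conj m n (A : 'M[C]_(m, n)) :
  mp_inv (map_mx Num.conj A) = map_mx Num.conj (mp_inv A).
Proof.
apply: (penrose_uniq (penrose_mp_inv _)).
have [a b c d] := penrose_mp_inv A.
by split; rewrite -!map_mxM ?a ?b // map_trmx ?c ?d.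
Qed.

End MoorePenrose.

Section TProduct.
Variable R : realType.

Definition tprod m n q p (A : tensor R m n p) (B : tensor R n q p) :
    tensor R m q p :=
  of_fourier (fun l => fourier A l *m fourier B l).

Definition ttr m n p (A : tensor R m n p) : tensor R n m p :=
  of_fourier (fun l => (fourier A l) ^t*).

Definition tid n p : tensor R n n p :=
  [ffun k : 'I_p => if k == 0%N :> nat then 1%:M else 0].

Definition t_invertible n p (A : tensor R n n p) : Prop :=
  forall l, fourier A l \in unitmx.

Definition tinv n p (A : tensor R n n p) : tensor R n n p :=
  of_fourier (fun l => invmx (fourier A l)).

Definition tpinv m n p (A : tensor R m n p) : tensor R n m p :=
  of_fourier (fun l => mp_inv (fourier A l)).

Definition fnorm m n p (A : tensor R m n p) : R :=
  Num.sqrt (\sum_(k < p) \sum_i \sum_j A k i j ^+ 2).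

(* A(I,:,:), A(:,J,:) and A(I,J,:) *)
Definition trows m n p s (I : s.-tuple 'I_m) (A : tensor R m n p) :
    tensor R s n p := [ffun k => rowsub (tnth I) (A k)].

Definition tcols m n p t (J : t.-tuple 'I_n) (A : tensor R m n p) :
    tensor R m t p := [ffun k => colsub (tnth J) (A k)].

Definition tsub m n p s t (I : s.-tuple 'I_m) (J : t.-tuple 'I_n)
    (A : tensor R m n p) : tensor R s t p :=
  [ffun k => mxsub (tnth I) (tnth J) (A k)].

Definition thin_tqr m r p (A Q : tensor R m r p) (T : tensor R r r p) : Prop :=
  [/\ A = tprod Q T, tprod (ttr Q) Q = tid r p
    & forall k (i j : 'I_r), (j < i)%N -> T k i j = 0].

Lemma fourier_tprod m n q p (A : tensor R m n p) (B : tensor R n q p) l :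
  fourier (tprod A B) l = fourier A l *m fourier B l.
Proof.
rewrite of_fourierK // => a b d.
by rewrite map_mxM -!(fourier_conj _ d).
Qed.

Lemma fourier_ttr m n p (A : tensor R m n p) l :
  fourier (ttr A) l = (fourier A l) ^t*.
Proof.
rewrite of_fourierK // => a b d.
by rewrite (fourier_conj _ d) map_trmx.
Qed.

Lemma fourier_tid n p l : fourier (tid n p) l = 1%:M.
Proof.
case: p l => [[]//|p] l; rewrite /fourier (bigD1 ord0) //= big1 ?addr0.
  by rewrite ffunE /= muln0 mulr0 mul0r oppr0 expi0 scale1r map_mx1.
by move=> k; rewrite ffunE -val_eqE /= => /negPf ->; rewrite map_mx0 scaler0.
Qed.

Lemma fourier_tinv n p (A : tensor R n n p) l :
  fourier (tinv A) l = invmx (fourier A l).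
Proof.
rewrite of_fourierK // => a b d.
by rewrite (fourier_conj _ d) map_invmx.
Qed.

Lemma fourier_tpinv m n p (A : tensor R m n p) l :
  fourier (tpinv A) l = mp_inv (fourier A l).
Proof.
rewrite of_fourierK // => a b d.
by rewrite (fourier_conj _ d) mp_inv_conj.
Qed.

End TProduct.

Section TARP.
Variables (R : realType) (n r p : nat).
Implicit Types (V W : tensor R n r p) (j : 'I_n) (s : seq 'I_n).

Definition sel_prob W j : R :=
  fnorm (trows [tuple j] W) ^+ 2 / fnorm W ^+ 2.

Definition arp_step W j : tensor R n r p :=
  let Z := trows [tuple j] W in
  tprod W (tid R r p - tprod (tpinv Z) Z).

(* The tensor W^(k) reached from V after the history s = (j_1, ..., j_k). *)
Definition arp_state V s : tensor R n r p := foldl arp_step V s.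

(* The probability that a run started at V first draws j_1, ..., j_k, i.e. the
   product of the successive conditional probabilities; on r-tuples it is the
   law of the output of T-ARP. *)
Fixpoint arp_prob V s : R :=
  if s is j :: s' then sel_prob V j * arp_prob (arp_step V j) s' else 1.

(* With s = J_{k-1}: slice_weight, mix_prob and slice_prob are a_{j,k}^(l),
   q_{j,k} and p_{j,k}^(l). *)
Definition slice_weight V s (l : 'I_p) j : R :=
  \sum_(c < r) Normc.normc (fourier (arp_state V s) l j c) ^+ 2.

Definition mix_prob V s j : R :=
  (\sum_(l < p) slice_weight V s l j)
  / (\sum_(i < n) \sum_(l < p) slice_weight V s l i).

Definition slice_prob V s (l : 'I_p) j : R :=
  slice_weight V s l j / (\sum_(i < n) slice_weight V s l i).

Definition index_mx k (J : k.-tuple 'I_n) : 'M[R[i]]_(n, k) :=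
  \matrix_(i, t) (i == tnth J t)%:R.

Definition freq_aligned V (eta : nat -> R) : Prop :=
  forall k, (1 <= k <= r)%N -> forall s : k.-1.-tuple 'I_n, 0 < arp_prob V s ->
  forall l j, 0 < slice_weight V s l j ->
    mix_prob V s j <= eta k * slice_prob V s l j.

Definition rank_growth V : Prop :=
  forall k, (k <= r)%N -> forall s : k.-tuple 'I_n, 0 < arp_prob V s ->
  forall l, \rank ((index_mx s) ^t* *m fourier V l) = k.

Definition alignment_assumption V (eta : nat -> R) : Prop :=
  freq_aligned V eta /\ rank_growth V.

Definition perfectly_aligned V (k : nat) : Prop :=
  forall s : k.-1.-tuple 'I_n, 0 < arp_prob V s ->
  forall l j, mix_prob V s j = slice_prob V s l j.

End TARP.

(* Joint law of (J, I): J from T-ARP on V and then, given J, I from T-ARP on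
   Q J with fresh randomness. *)
Definition tcur_prob (R : realType) n1 n2 r p (V : tensor R n2 r p)
    (Q : r.-tuple 'I_n2 -> tensor R n1 r p)
    (JI : r.-tuple 'I_n2 * r.-tuple 'I_n1) : R :=
  arp_prob V JI.1 * arp_prob (Q JI.1) JI.2.

(* Expectation of f under the finitely supported law w. *)
Definition expect (R : realType) (T : finType) (w f : T -> R) : R :=
  \sum_x w x * f x.

Definition Gamma (R : realType) (r : nat) (eta : nat -> R) : R :=
  \prod_(1 <= k < r.+1) (1 + eta k / (r - k + 1)%:R).

(* Main.v *)
Require Import Defs.
From mathcomp Require Import all_boot all_order all_algebra.
From mathcomp Require Import complex.
From mathcomp Require Import boolp classical_sets reals topology normedtype trigo.

(** Everything is done one frequency at a time.  Let U be a Fourier slice of the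
    basis, W = U P its deflation after the history s, and Y a matrix with as many
    rows as U.  Start from the residual A = Y - U U^* Y and, when row j is
    selected, subtract the multiple of W z^* (z the row j of W) that clears the
    row j of A.  Since W is a partial isometry with W^* A = 0, the new residual
    has squared norm |A|^2 + |row j A|^2 / |z|^2; averaging against the selection
    probabilities, alignment gives the factor 1 + eta_k / (r-k+1).  The residual
    stays of the form Y - U M, and after r steps it vanishes on the rows J, so it
    is the interpolation error Y - U U_J^-1 Y_J.

    The CUR error is the interpolation error of X in the basis Q; it is bounded in
    mean by |X - Q Q^* X|^2, hence by the error of approximating X by any
    combination of the columns X(:,J), in particular by the adjoint of the
    interpolant of X^* in the basis V. *)

Set Implicit Arguments.
Unset Strict Implicit.
Unset Printing Implicit Defensive.

Import Order.TTheory GRing.Theory Num.Theory.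

Local Open Scope ring_scope.
Local Open Scope complex_scope.
Local Open Scope sesquilinear_scope.

(** * Conjugate transposes, inverses, and the pseudoinverse of a row *)

Section Adjoint.
Variable C : numClosedFieldType.

Lemma adjmxM m n q (A : 'M[C]_(m, n)) (B : 'M[C]_(n, q)) :
  (A *m B) ^t* = B ^t* *m A ^t*.
Proof. by rewrite trmx_mul map_mxM. Qed.

Lemma adjmxB m n (A B : 'M[C]_(m, n)) : (A - B) ^t* = A ^t* - B ^t*.
Proof. by rewrite linearB map_mxB. Qed.

Lemma adjmxZ m n (a : C) (A : 'M[C]_(m, n)) : (a *: A) ^t* = Num.conj a *: A ^t*.
Proof. by rewrite linearZ map_mxZ. Qed.

(** The Penrose equations have a unique solution, and [a^-1 *: z ^t*] satisfies them. The last
    equation uses that [a] is real, since [z *m z ^t*] is Hermitian. *)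
Lemma mp_inv_row n (z : 'rV[C]_n) (a : C) :
  a != 0 -> z *m z ^t* = a%:M -> mp_inv z = a^-1 *: z ^t*.
Proof.
move=> a0 za; apply: (penrose_uniq (penrose_mp_inv z)).
have ar : Num.conj a = a.
  have : (a%:M : 'M[C]_1) ^t* = a%:M by rewrite -za adjmxM trmxCK.
  by rewrite tr_scalar_mx map_scalar_mx => /matrixP/(_ 0 0); rewrite !mxE !mulr1n.
split.
- by rewrite -scalemxAr za scale_scalar_mx mulVf // mul1mx.
- by rewrite -!scalemxAl -scalemxAr -mulmxA za mul_mx_scalar scalerA mulVf ?scale1r.
- by rewrite -scalemxAr za scale_scalar_mx mulVf // tr_scalar_mx map_scalar_mx rmorph1.
- by rewrite -scalemxAl adjmxZ adjmxM trmxCK fmorphV /= ar.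
Qed.

Lemma invmxM n (A B : 'M[C]_n) :
  A \in unitmx -> B \in unitmx -> invmx (A *m B) = invmx B *m invmx A.
Proof.
move=> uA uB; have uAB : A *m B \in unitmx by rewrite unitmx_mul uA.
by rewrite -[RHS](mulmxK uAB) -!mulmxA (mulKmx uA) (mulKmx uB).
Qed.

End Adjoint.

(** * Squared Frobenius norms *)

Section Frobenius.
Variable R : realType.

(** Valued in [R] so that it can be averaged; trace identities are proved in [R[i]] and pulled back
    by [complexI]. *)
Definition frob2 m n (M : 'M[R[i]]_(m, n)) : R :=
  \sum_i \sum_j Normc.normc (M i j) ^+ 2.

Lemma frob2_ge0 m n (M : 'M_(m, n)) : 0 <= frob2 M.
Proof. by do 2!apply: sumr_ge0 => ? _; apply: sqr_ge0. Qed.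

Lemma normc_sqr (z : R[i]) : (Normc.normc z ^+ 2)%:C = z * Num.conj z.
Proof. by rewrite rmorphXn -normCK. Qed.

Lemma frob2_trace m n (M : 'M_(m, n)) : (frob2 M)%:C = \tr (M *m M ^t*).
Proof.
rewrite /frob2 /mxtrace rmorph_sum; apply: eq_bigr => i _.
rewrite rmorph_sum !mxE; apply: eq_bigr => j _.
by rewrite !mxE -normc_sqr.
Qed.

Lemma frob2_adj m n (M : 'M_(m, n)) : frob2 (M ^t*) = frob2 M.
Proof. by apply: complexI; rewrite !frob2_trace trmxCK mxtrace_mulC. Qed.

(** The cross terms in the trace of [(A - B) ^t* *m (A - B)] are, up to sign, [A ^t* *m B] and its
    adjoint. *)
Lemma frob2_pythagoras m n (A B : 'M_(m, n)) :
  A ^t* *m B = 0 -> frob2 (A - B) = frob2 A + frob2 B.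
Proof.
move=> AB; have BA : B ^t* *m A = 0.
  by rewrite -[LHS]trmxCK adjmxM trmxCK AB trmx0 map_mx0.
apply: complexI; rewrite rmorphD.
rewrite -(frob2_adj (A - B)) -(frob2_adj A) -(frob2_adj B).
rewrite /= !frob2_trace !trmxCK adjmxB mulmxBl !mulmxBr AB BA.
by rewrite subr0 sub0r opprK linearD.
Qed.

Lemma frob2_row n (z : 'rV_n) : z *m z ^t* = (frob2 z)%:C%:M.
Proof. by rewrite frob2_trace trace_mx11 [LHS]mx11_scalar. Qed.

Lemma frob2_rows m n (M : 'M_(m, n)) : \sum_i frob2 (row i M) = frob2 M.
Proof.
apply: eq_bigr => i _; rewrite /frob2 big_ord1.
by apply: eq_bigr => j _; rewrite mxE.
Qed.

Lemma frob2_eq0 m n (M : 'M_(m, n)) : frob2 M = 0 -> M = 0.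
Proof.
move/eqP; rewrite psumr_eq0 => [|i _]; last first.
  by apply: sumr_ge0 => j _; apply: sqr_ge0.
move/allP => h; apply/matrixP => i j; have := h i (mem_index_enum _).
rewrite psumr_eq0 => [|k _]; last exact: sqr_ge0.
move/allP/(_ j (mem_index_enum _)); rewrite expf_eq0 /= mxE.
by move/eqP/Normc.eq0_normc.
Qed.

(** [D] is the sum of [Q *m Q ^t* *m D] and a remainder orthogonal to it. *)
Lemma frob2_proj_le m n r (Q : 'M_(m, r)) (D : 'M_(m, n)) :
  Q ^t* *m Q = 1%:M -> frob2 (D - Q *m Q ^t* *m D) <= frob2 D.
Proof.
move=> QQ; set D' := D - _.
have h : D' ^t* *m (Q *m (- (Q ^t* *m D))) = 0.
  rewrite mulmxA /D' adjmxB !adjmxM trmxCK mulmxBl.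
  by rewrite -!mulmxA QQ mulmx1 subrr mul0mx.
have -> : frob2 D = frob2 (D' - Q *m (- (Q ^t* *m D))).
  by rewrite mulmxN opprK mulmxA subrK.
by rewrite (frob2_pythagoras h) lerDl frob2_ge0.
Qed.

Lemma conj_realC (a : R) : Num.conj a%:C = a%:C.
Proof. exact: conjc_real. Qed.

Lemma frob2Z m n (a : R) (M : 'M_(m, n)) : frob2 (a%:C *: M) = a ^+ 2 * frob2 M.
Proof.
apply: complexI; rewrite frob2_trace adjmxZ conj_realC -scalemxAl -scalemxAr scalerA.
by rewrite mxtraceZ -frob2_trace -!rmorphM /= expr2.
Qed.

Lemma frob2_rank1 m n (u : 'cV_m) (v : 'rV_n) :
  frob2 (u *m v) = frob2 u * frob2 v.
Proof.
apply: complexI; rewrite rmorphM /= !frob2_trace adjmxM -mulmxA (mulmxA v).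
rewrite frob2_row mul_scalar_mx -scalemxAr mxtraceZ -!frob2_trace.
by rewrite mxtrace_scalar mulr1n mulrC.
Qed.

(** * One deflation of the basis and the matching residual update *)

Section Step.
Variables (n r : nat).
Implicit Type W : 'M[R[i]]_(n, r).

(** Orthogonal projector onto the line of [z ^t*]; since the inverse of 0 is 0, it is the zero
    matrix when [z = 0]. *)
Definition row_proj (z : 'rV[R[i]]_r) : 'M_r :=
  ((frob2 z)^-1)%:C *: (z ^t* *m z).

Definition deflate W j : 'M_(n, r) := W *m (1%:M - row_proj (row j W)).

Lemma row_projK (z : 'rV_r) : z *m row_proj z = z.
Proof.
have [z0|z0] := eqVneq (frob2 z) 0; first by rewrite (frob2_eq0 z0) mul0mx.
rewrite /row_proj -scalemxAr mulmxA frob2_row mul_scalar_mx scalerA -rmorphM /=.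
by rewrite mulVf ?scale1r.
Qed.

Lemma row_proj_adj (z : 'rV_r) : (row_proj z) ^t* = row_proj z.
Proof. by rewrite /row_proj adjmxZ adjmxM trmxCK conj_realC. Qed.

Lemma row_projKl (z : 'rV_r) : row_proj z *m z ^t* = z ^t*.
Proof. by rewrite -{1}row_proj_adj -adjmxM row_projK. Qed.

Lemma row_proj_idem (z : 'rV_r) : row_proj z *m row_proj z = row_proj z.
Proof. by rewrite {1 3}/row_proj -scalemxAl -mulmxA row_projK. Qed.

Lemma row_proj_trace (z : 'rV_r) : z != 0 -> \tr (row_proj z) = 1.
Proof.
move=> z0; rewrite /row_proj mxtraceZ mxtrace_mulC -frob2_trace -rmorphM mulVf //.
by apply: contraNneq z0 => /frob2_eq0 ->.
Qed.

Section PartialIsometry.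
Variables (W : 'M[R[i]]_(n, r)) (j : 'I_n).
Hypothesis W_iso : W *m W ^t* *m W = W.
Let z := row j W.
Let P := row_proj z.

Lemma row_gram : z *m W ^t* *m W = z.
Proof. by rewrite /z -!row_mul W_iso. Qed.

Lemma gram_row : W ^t* *m (W *m z ^t*) = z ^t*.
Proof. by rewrite -[in RHS]row_gram !adjmxM trmxCK mulmxA. Qed.

Lemma proj_gram : P *m (W ^t* *m W) = P.
Proof. by rewrite /P /row_proj -scalemxAl -!mulmxA (mulmxA z) row_gram. Qed.

(** [W ^t* *m W] is an orthogonal projector fixing [z ^t*], hence it absorbs [P] on both sides. *)
Lemma deflate_gram :
  (deflate W j) ^t* *m deflate W j = W ^t* *m W - P.
Proof.
have GP : W ^t* *m W *m P = P.
  by have := congr1 (fun M => M ^t*) proj_gram; rewrite !adjmxM trmxCK row_proj_adj.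
rewrite /deflate adjmxM adjmxB tr_scalar_mx map_scalar_mx rmorph1 row_proj_adj -/P.
rewrite -mulmxA (mulmxA (W ^t*)) mulmxBl mul1mx mulmxBr mulmx1 GP.
by rewrite mulmxBr proj_gram row_proj_idem subrr subr0.
Qed.

Lemma deflate_iso : deflate W j *m (deflate W j) ^t* *m deflate W j = deflate W j.
Proof.
rewrite -mulmxA deflate_gram /deflate -mulmxA -/z -/P.
rewrite [(1%:M - P) *m _]mulmxBl mul1mx [P *m _]mulmxBr proj_gram row_proj_idem.
by rewrite subrr subr0 !mulmxBr mulmxA W_iso mulmx1.
Qed.

(** Traces in [deflate_gram]: a rank-one projector has trace 1. *)
Lemma frob2_deflate : z != 0 -> frob2 (deflate W j) = frob2 W - 1.
Proof.
move=> z0; apply: complexI; rewrite rmorphB /=.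
rewrite -(frob2_adj (deflate W j)) -(frob2_adj W).
by rewrite !frob2_trace !trmxCK deflate_gram linearB /= row_proj_trace.
Qed.

(** Deflation subtracts [W *m P], whose rank is at most one. *)
Lemma rank_deflate : (\rank W <= (\rank (deflate W j)).+1)%N.
Proof.
have {1}-> : W = deflate W j + W *m P by rewrite /deflate mulmxBr mulmx1 subrK.
apply: leq_trans (mxrank_add _ _) _; rewrite -addn1 leq_add2l.
apply: leq_trans (mxrankM_maxr _ _) _; rewrite /P /row_proj scalemxAl.
by apply: leq_trans (mxrankM_maxr _ _) _; apply: rank_leq_row.
Qed.

Lemma row_deflate : row j (deflate W j) = 0.
Proof. by rewrite /deflate row_mul mulmxBr mulmx1 row_projK subrr. Qed.

Lemma row_deflate0 i : row i W = 0 -> row i (deflate W j) = 0.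
Proof. by rewrite /deflate row_mul => ->; rewrite mul0mx. Qed.

Variables (m : nat) (A : 'M[R[i]]_(n, m)).
Hypothesis WA : W ^t* *m A = 0.
Hypothesis z0 : z != 0.

Let fz0 : frob2 z != 0.
Proof. by apply: contraNneq z0 => /frob2_eq0 ->. Qed.

(* The multiple of W z^* that clears row j of A; it lies in the column space of
   W, to which A is orthogonal. *)
Definition resid_step : 'M_(n, m) :=
  A - (W *m z ^t*) *m (((frob2 z)^-1)%:C *: row j A).

Lemma row_resid_step : row j resid_step = 0.
Proof.
rewrite /resid_step linearB /= 2!row_mul frob2_row mul_scalar_mx scalerA.
by rewrite -rmorphM /= mulfV // scale1r subrr.
Qed.

Lemma row_resid_step0 i : row i W = 0 -> row i A = 0 -> row i resid_step = 0.
Proof.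
by move=> Wi Ai; rewrite /resid_step linearB /= 2!row_mul Wi Ai !mul0mx subrr.
Qed.

(** [W ^t*] kills [A] and maps [W *m z ^t*] to [z ^t*], which [1%:M - P] annihilates. *)
Lemma resid_step_orth : (deflate W j) ^t* *m resid_step = 0.
Proof.
rewrite /deflate adjmxM adjmxB tr_scalar_mx map_scalar_mx rmorph1 row_proj_adj.
rewrite -mulmxA /resid_step mulmxBr WA mulmxA gram_row sub0r mulmxN mulmxA.
by rewrite mulmxBl mul1mx row_projKl subrr mul0mx oppr0.
Qed.

(** Pythagoras: the correction is orthogonal to [A], and [W] preserves the norm of [z ^t*], so its
    squared norm is [|z|^2 |row j A|^2 / |z|^4]. *)
Lemma frob2_resid_step : frob2 resid_step = frob2 A + frob2 (row j A) / frob2 z.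
Proof.
rewrite /resid_step frob2_pythagoras; last first.
  rewrite 2!mulmxA -[A ^t* *m W]trmxCK adjmxM trmxCK WA trmx0 map_mx0.
  by rewrite !mul0mx.
rewrite frob2_rank1 frob2Z; congr (_ + _).
have -> : frob2 (W *m z ^t*) = frob2 z.
  apply: complexI; rewrite -frob2_adj !frob2_trace trmxCK adjmxM trmxCK.
  by rewrite -mulmxA gram_row.
by rewrite expr2 -!mulrA mulVKf // mulrC.
Qed.

End PartialIsometry.
End Step.
End Frobenius.

(** * Fourier slices of tensor operations, and Parseval *)

Section TensorFourier.
Variable R : realType.

Lemma fourierB m n p (A B : tensor R m n p) l :
  fourier (A - B) l = fourier A l - fourier B l.
Proof.
rewrite /fourier -sumrB; apply: eq_bigr => k _.
by rewrite -scalerBr !ffunE map_mxB.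
Qed.

Lemma fourier_mxsub m n p s t (f : 'I_s -> 'I_m) (g : 'I_t -> 'I_n)
    (A : tensor R m n p) l :
  fourier [ffun k => mxsub f g (A k)] l = mxsub f g (fourier A l).
Proof.
apply/matrixP => i j; rewrite !mxE !summxE; apply: eq_bigr => k _.
by rewrite ffunE !mxE.
Qed.

(** The transform is unnormalised, whence the factor [p]. Each squared entry expands into a double
    sum over frontal slices, and summing over frequencies leaves the diagonal by [expi_orth]. *)
Lemma fourier_parseval m n p (A : tensor R m n p) :
  \sum_l frob2 (fourier A l) = p%:R * fnorm A ^+ 2.
Proof.
rewrite /fnorm sqr_sqrtr; last first.
  by do 3!apply: sumr_ge0 => ? _; apply: sqr_ge0.
rewrite /frob2 mulr_sumr; under [RHS]eq_bigr do rewrite mulr_sumr.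
rewrite exchange_big [RHS]exchange_big; apply: eq_bigr => i _ /=.
under [RHS]eq_bigr do rewrite mulr_sumr.
rewrite exchange_big [RHS]exchange_big; apply: eq_bigr => j _ /=.
apply: complexI; rewrite !rmorph_sum /=.
pose e (k l : 'I_p) := expi (- (2 * pi * (k * l)%:R / p%:R)) : R[i].
have eC k l : Num.conj (e k l) = expi (2 * pi * (k * l)%:R / p%:R).
  by rewrite /e expi_conj opprK.
have fE (l : 'I_p) : fourier A l i j = \sum_k e k l * (A k i j)%:C.
  by rewrite summxE; apply: eq_bigr => k _; rewrite !mxE mulnC.
transitivity (\sum_l \sum_k \sum_k' (e k l * Num.conj (e k' l)) *
   ((A k i j)%:C * (A k' i j)%:C)).
  apply: eq_bigr => l _; rewrite normc_sqr fE rmorph_sum big_distrlr /=.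
  by do 2!apply: eq_bigr => ? _; rewrite rmorphM /= conj_realC mulrACA.
rewrite exchange_big; apply: eq_bigr => k _; rewrite exchange_big /=.
under eq_bigr => k' _.
  rewrite -mulr_suml; under eq_bigr do rewrite eC.
  rewrite expi_orth; over.
rewrite (bigD1 k) //= eqxx big1 ?addr0 => [|k' kk'].
  by rewrite rmorphM rmorph_nat -expr2 rmorphXn.
by rewrite eq_sym (negPf kk') mul0r.
Qed.

Lemma fourier_orth m r p (V : tensor R m r p) l :
  tprod (ttr V) V = tid R r p -> (fourier V l) ^t* *m fourier V l = 1%:M.
Proof. by move=> h; rewrite -fourier_ttr -fourier_tprod h fourier_tid. Qed.

End TensorFourier.

(** * The law of T-ARP and the Fourier slices of its states *)

Lemma sum_rcons_tuple (R : nmodType) (T : finType) k (F : seq T -> R) :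
  \sum_(t : k.+1.-tuple T) F t = \sum_(s : k.-tuple T) \sum_j F (rcons s j).
Proof.
rewrite pair_big /= (reindex (fun sj : k.-tuple T * T => [tuple of rcons sj.1 sj.2])) //.
apply: onW_bij; apply: inj_card_bij => [[s j] [s' j'] /(congr1 val) /= /rcons_inj []|].
  by move=> /val_inj -> ->.
by rewrite card_prod !card_tuple expnSr.
Qed.

Section ARP.
Variables (R : realType) (n r p : nat).
Implicit Types (V : tensor R n r p) (s : seq 'I_n) (j : 'I_n).

Lemma arp_state_rcons V s j : arp_state V (rcons s j) = arp_step (arp_state V s) j.
Proof. exact: foldl_rcons. Qed.

(** [arp_prob] unfolds from the first draw, whereas the estimates condition on all draws but the
    last. *)
Lemma arp_prob_rcons V s j :
  arp_prob V (rcons s j) = arp_prob V s * sel_prob (arp_state V s) j.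
Proof.
elim: s V => [|i s IH] V /=; first by rewrite mulr1 mul1r.
by rewrite IH mulrA.
Qed.

Lemma sel_prob_ge0 V j : 0 <= sel_prob V j.
Proof. by rewrite divr_ge0 ?sqr_ge0. Qed.

Lemma arp_prob_ge0 V s : 0 <= arp_prob V s.
Proof. by elim: s V => //= j s IH V; rewrite mulr_ge0 ?sel_prob_ge0. Qed.

Lemma arp_prob_rcons_gt0 V s j : 0 < arp_prob V (rcons s j) ->
  0 < arp_prob V s /\ 0 < sel_prob (arp_state V s) j.
Proof.
rewrite arp_prob_rcons !lt0r mulf_eq0 negb_or arp_prob_ge0 sel_prob_ge0.
by case/andP => /andP[-> ->].
Qed.

Lemma fourier_row V j l : fourier (trows [tuple j] V) l = row j (fourier V l).
Proof. by rewrite fourier_mxsub; apply/matrixP => i k; rewrite !mxE ord1. Qed.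

(** The nonzero row makes [mp_inv_row] applicable, with [a] the squared norm of that row. *)
Lemma fourier_arp_step V j l : row j (fourier V l) != 0 ->
  fourier (arp_step V j) l = deflate (fourier V l) j.
Proof.
move=> z0; rewrite fourier_tprod fourierB fourier_tid fourier_tprod fourier_tpinv.
rewrite fourier_row (@mp_inv_row _ _ _ (frob2 (row j (fourier V l)))%:C).
- by rewrite /deflate /row_proj -scalemxAl fmorphV.
- by rewrite fmorph_eq0; apply: contraNneq z0 => /frob2_eq0 ->.
- exact: frob2_row.
Qed.

Lemma slice_weightE V s l j :
  slice_weight V s l j = frob2 (row j (fourier (arp_state V s) l)).
Proof. by rewrite /frob2 big_ord1; apply: eq_bigr => c _; rewrite mxE. Qed.

(** Parseval in numerator and denominator; the two factors [p] cancel. *)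
Lemma mix_probE V s j : (0 < p)%N -> mix_prob V s j = sel_prob (arp_state V s) j.
Proof.
move=> p0; have pn : (p%:R != 0 :> R) by rewrite pnatr_eq0 -lt0n.
have num : \sum_l slice_weight V s l j =
    p%:R * fnorm (trows [tuple j] (arp_state V s)) ^+ 2.
  by rewrite -fourier_parseval; apply: eq_bigr => l _; rewrite slice_weightE fourier_row.
have den : \sum_i \sum_l slice_weight V s l i = p%:R * fnorm (arp_state V s) ^+ 2.
  rewrite -fourier_parseval exchange_big; apply: eq_bigr => l _.
  by rewrite -frob2_rows; apply: eq_bigr => i _; rewrite slice_weightE.
by rewrite /mix_prob num den -mulf_div divff ?mul1r.
Qed.

(** Only an inequality: for a null tensor, division by zero makes the total mass 0. *)
Lemma sum_sel_prob_le1 V : (0 < p)%N -> \sum_j sel_prob V j <= 1.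
Proof.
move=> p0; rewrite (eq_bigr (mix_prob V [::])) => [|j _]; last by rewrite mix_probE.
rewrite -mulr_suml; set D := \sum_i _.
by have [->|/divff ->] := eqVneq D 0; rewrite ?mul0r ?ler01.
Qed.

Lemma index_mx_mul k (s : k.-tuple 'I_n) m (M : 'M_(n, m)) :
  (index_mx R s) ^t* *m M = rowsub (tnth s) M.
Proof.
apply/matrixP => i j; rewrite !mxE (bigD1 (tnth s i)) //= big1 => [|a ai].
  by rewrite !mxE eqxx conjC1 mul1r addr0.
by rewrite !mxE (negPf ai) conjC0 mul0r.
Qed.

(** The norm is the denominator of [slice_prob]; the last three clauses, with rank growth, force the
    next selected row to be nonzero. *)
Definition arp_invariant V s l :=
  let W := fourier (arp_state V s) l in
  [/\ W *m W ^t* *m W = W, frob2 W = (r - size s)%:R,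
      (r <= size s + \rank W)%N, exists P, W = fourier V l *m P
    & forall i, i \in s -> row i W = 0].

(* If the row vanished, the k+1 rows of V selected so far, which have rank k+1,
   would be annihilated by a matrix of rank r-k. *)
Lemma arp_row_neq0 V s j l : rank_growth V -> (size s < r)%N ->
  arp_invariant V s l -> 0 < arp_prob V (rcons s j) ->
  row j (fourier (arp_state V s) l) != 0.
Proof.
move=> rk sr [_ _ rkW [P WE] W0] pos; apply/eqP => z0.
set E := rowsub (tnth (in_tuple (rcons s j))) (fourier V l).
have rkE : \rank E = (size s).+1.
  by rewrite /E -index_mx_mul rk ?size_rcons.
have EP : E *m P = 0.
  rewrite /E mul_rowsub_mx -WE; apply/row_matrixP => i; rewrite row0.
  rewrite row_rowsub; have := mem_tnth i (in_tuple (rcons s j)).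
  by rewrite mem_rcons inE => /predU1P[->|/W0].
have := mulmx0_rank_max EP; rewrite rkE leqNgt => /negP; apply.
rewrite addSn ltnS (leq_trans rkW) // leq_add2l WE; exact: mxrankM_maxr.
Qed.

(** Induction on the last draw: its row is nonzero by [arp_row_neq0], so the step is a deflation,
    which lowers the squared norm by exactly 1 and the rank by at most 1. *)
Lemma arp_invariantP V s l : rank_growth V -> tprod (ttr V) V = tid R r p ->
  (size s <= r)%N -> 0 < arp_prob V s -> arp_invariant V s l.
Proof.
move=> rk Vo; elim/last_ind: s => [_ _|s j IH].
  have VV := fourier_orth l Vo; rewrite /arp_invariant /=; split => //.
  - by rewrite -mulmxA VV mulmx1.
  - apply: complexI; rewrite -frob2_adj frob2_trace trmxCK VV mxtrace1.
    by rewrite subn0 rmorph_nat.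
  - rewrite add0n -{1}(mxrank1 R[i] r) -VV; exact: mxrankM_maxr.
  - by exists 1%:M; rewrite mulmx1.
rewrite size_rcons => sr pos; have [pos0 _] := arp_prob_rcons_gt0 pos.
have inv := IH (ltnW sr) pos0; have z0 := arp_row_neq0 rk sr inv pos.
have [iso fr rkW [P WE] W0] := inv.
rewrite /arp_invariant arp_state_rcons fourier_arp_step // size_rcons; split.
- exact: deflate_iso.
- by rewrite frob2_deflate // fr -subnSK // -addn1 natrD addrK.
- by rewrite addSnnS (leq_trans rkW) // leq_add2l rank_deflate.
- by eexists; rewrite /deflate WE -mulmxA.
- move=> i; rewrite mem_rcons inE => /predU1P[->|/W0]; first exact: row_deflate.
  exact: row_deflate0.
Qed.

(** The basis is carried along, so that each draw corrects [A] with the current deflated slice. *)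
Fixpoint arp_resid l V m (A : 'M[R[i]]_(n, m)) s : 'M_(n, m) :=
  if s is j :: s' then
    arp_resid l (arp_step V j) (resid_step (fourier V l) j A) s'
  else A.

Lemma arp_resid_rcons l V m (A : 'M_(n, m)) s j :
  arp_resid l V A (rcons s j) =
  resid_step (fourier (arp_state V s) l) j (arp_resid l V A s).
Proof. by elim: s V A => [//|i s IH] V A; exact: IH. Qed.

(** * Expected interpolation error at one frequency *)

Section Expectation.
Variables (V : tensor R n r p) (l : 'I_p) (m : nat) (Y : 'M[R[i]]_(n, m)).
Hypotheses (rk : rank_growth V) (V_orth : tprod (ttr V) V = tid R r p).
Let U := fourier V l.
Let A0 := Y - U *m U ^t* *m Y.

Lemma arp_residP s : (size s <= r)%N -> 0 < arp_prob V s ->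
  [/\ (fourier (arp_state V s) l) ^t* *m arp_resid l V A0 s = 0,
      forall i, i \in s -> row i (arp_resid l V A0 s) = 0
    & exists M, arp_resid l V A0 s = Y - U *m M].
Proof.
elim/last_ind: s => [_ _|s j IH].
  split=> //=; last by exists (U ^t* *m Y); rewrite mulmxA.
  by rewrite mulmxBr !mulmxA -/U (fourier_orth l V_orth) mul1mx subrr.
rewrite size_rcons => sr pos; have [pos0 _] := arp_prob_rcons_gt0 pos.
have inv := arp_invariantP l rk V_orth (ltnW sr) pos0.
have z0 := arp_row_neq0 rk sr inv pos.
have [iso _ _ [P WE] W0] := inv.
have [WA A_0 [M AE]] := IH (ltnW sr) pos0.
rewrite arp_resid_rcons arp_state_rcons fourier_arp_step //; split.
- exact: resid_step_orth.
- move=> i; rewrite mem_rcons inE => /predU1P[->|is_]; first exact: row_resid_step.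
  by apply: row_resid_step0; [apply: W0 | apply: A_0].
(* [W] factors through [U], so the correction is absorbed into [M]. *)
- rewrite /resid_step AE WE -!mulmxA.
  by eexists; rewrite -addrA -opprD -mulmxDr.
Qed.


Variable eta : nat -> R.
Hypotheses (p_gt0 : (0 < p)%N) (al : freq_aligned V eta).
Hypothesis eta_ge1 : forall k, (1 <= k <= r)%N -> 1 <= eta k.

(* The selection probability q_j absorbs the factor 1/|z|^2 gained by the
   residual: q_j / |z_j|^2 <= eta_k / (r-k+1), since the weights |z_j|^2 sum to
   |W|^2 = r-k+1. *)
Lemma arp_resid_step_le s : (size s < r)%N -> 0 < arp_prob V s ->
  \sum_j sel_prob (arp_state V s) j * frob2 (arp_resid l V A0 (rcons s j)) <=
  (1 + eta (size s).+1 / (r - size s)%:R) * frob2 (arp_resid l V A0 s).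
Proof.
move=> sr pos; set W := fourier (arp_state V s) l; set A := arp_resid l V A0 s.
have inv := arp_invariantP l rk V_orth (ltnW sr) pos.
have [iso fr _ _ _] := inv.
have [WA _ _] := arp_residP (ltnW sr) pos.
have e0 : 0 <= eta (size s).+1 / (r - size s)%:R.
  by rewrite divr_ge0 // (le_trans ler01) // eta_ge1.
(* The bound is proved draw by draw: a null draw contributes 0 on the left, and any other has a
   nonzero row, so alignment applies. *)
apply: (@le_trans _ _ (\sum_j (sel_prob (arp_state V s) j * frob2 A +
    eta (size s).+1 / (r - size s)%:R * frob2 (row j A)))).
  apply: ler_sum => j _; have := sel_prob_ge0 (arp_state V s) j.
  rewrite le_eqVlt => /predU1P[<-|q0].
    by rewrite !mul0r add0r mulr_ge0 ?frob2_ge0.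
  have posj : 0 < arp_prob V (rcons s j) by rewrite arp_prob_rcons mulr_gt0.
  have z0 := arp_row_neq0 rk sr inv posj.
  rewrite arp_resid_rcons (frob2_resid_step iso WA z0) mulrDr lerD2l.
  have a0 : 0 < frob2 (row j W).
    by rewrite lt0r frob2_ge0 andbT; apply: contraNneq z0 => /frob2_eq0 ->.
  have := @al (size s).+1 sr (in_tuple s) pos l j.
  rewrite /slice_prob mix_probE // slice_weightE => /(_ a0).
  rewrite (eq_bigr (fun i => frob2 (row i W))) => [|i _]; last by rewrite slice_weightE.
  rewrite frob2_rows fr => q_le.
  rewrite mulrA mulrAC ler_wpM2r ?frob2_ge0 // ler_pdivrMr //.
  by rewrite mulrAC -mulrA.
rewrite big_split /= -mulr_suml -mulr_sumr frob2_rows mulrDl lerD2r.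
by rewrite ler_wpM2r ?frob2_ge0 // sum_sel_prob_le1.
Qed.

(** Condition on the first draws and apply [arp_resid_step_le] to the last one; null histories
    contribute 0. *)
Lemma arp_resid_expect k : (k <= r)%N ->
  \sum_(s : k.-tuple 'I_n) arp_prob V s * frob2 (arp_resid l V A0 s) <=
  (\prod_(1 <= i < k.+1) (1 + eta i / (r - i + 1)%:R)) * frob2 A0.
Proof.
elim: k => [_|k IH kr].
  rewrite (big_pred1 [tuple]) => [|s]; last by apply/esym/eqP/tuple0.
  by rewrite big_geq //= !mul1r.
rewrite (sum_rcons_tuple k (fun s => arp_prob V s * frob2 (arp_resid l V A0 s))).
rewrite big_nat_recr //= [X in X * frob2 A0]mulrC -mulrA.
(* Draw [k.+1] sees a history of length [k], hence the denominator [r - k]. *)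
have -> : (r - k.+1 + 1 = r - k)%N by rewrite addn1 subnSK.
have e0 : 0 <= 1 + eta k.+1 / (r - k)%:R.
  by rewrite addr_ge0 // divr_ge0 // (le_trans ler01) // eta_ge1.
apply: le_trans (ler_wpM2l e0 (IH (ltnW kr))).
rewrite mulr_sumr; apply: ler_sum => s _.
under eq_bigr do rewrite arp_prob_rcons -mulrA.
rewrite -mulr_sumr mulrCA; have := arp_prob_ge0 V s.
rewrite le_eqVlt => /predU1P[<-|pos]; first by rewrite !mul0r.
rewrite ler_pM2l //; have := @arp_resid_step_le s; rewrite size_tuple; exact.
Qed.

Lemma arp_rowsub_unit (J : r.-tuple 'I_n) : 0 < arp_prob V J ->
  rowsub (tnth J) U \in unitmx.
Proof.
by move=> pos; rewrite -row_full_unit /row_full -index_mx_mul rk.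
Qed.

(** Vanishing on the rows [J] reads [U_J M = Y_J], which determines [M]. *)
Lemma interpolation_residual (J : r.-tuple 'I_n) M (B : 'M_(n, m)) :
  rowsub (tnth J) U \in unitmx -> rowsub (tnth J) B = 0 -> B = Y - U *m M ->
  B = Y - U *m (invmx (rowsub (tnth J) U) *m rowsub (tnth J) Y).
Proof.
move=> uJ BJ BE; rewrite {1}BE; congr (_ - _ *m _).
apply: (canRL (mulKmx uJ)); rewrite mul_rowsub_mx.
by move/eqP: BJ; rewrite BE linearB subr_eq0 => /eqP /= ->.
Qed.

(** After [r] draws the residual vanishes on every selected row, so for each [J] of positive
    probability it is the interpolation error. *)
Lemma arp_interpolation_expect :
  \sum_(J : r.-tuple 'I_n) arp_prob V J *
    frob2 (Y - U *m (invmx (rowsub (tnth J) U) *m rowsub (tnth J) Y)) <=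
  Gamma r eta * frob2 (Y - U *m U ^t* *m Y).
Proof.
apply: le_trans (arp_resid_expect (leqnn r)).
apply: ler_sum => J _; have := arp_prob_ge0 V J.
rewrite le_eqVlt => /predU1P[<-|pos]; first by rewrite !mul0r.
have [|_ A_0 [M AE]] := @arp_residP J _ pos; first by rewrite size_tuple.
rewrite -(interpolation_residual (arp_rowsub_unit pos) _ AE) //.
by apply/row_matrixP => i; rewrite row_rowsub row0 A_0 ?mem_tnth.
Qed.

End Expectation.
End ARP.

(** * From interpolation errors to the CUR error *)

Lemma frob2_tqr_proj_le (R : realType) n1 n2 r p (X : tensor R n1 n2 p)
    (J : r.-tuple 'I_n2) (Q : tensor R n1 r p) (T : tensor R r r p) l
    (N : 'M_(r, n2)) : thin_tqr (tcols J X) Q T ->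
  frob2 (fourier X l - fourier Q l *m (fourier Q l) ^t* *m fourier X l) <=
  frob2 (fourier X l - colsub (tnth J) (fourier X l) *m N).
Proof.
case=> CE /(fourier_orth l) QQ _.
have CE' : colsub (tnth J) (fourier X l) = fourier Q l *m fourier T l.
  by rewrite -fourier_mxsub -fourier_tprod -CE.
(* The columns of [C N] lie in the range of [Q], so [D] and [X] leave the same remainder after
   projection. *)
set D := fourier X l - colsub _ _ *m N; apply: le_trans (frob2_proj_le D QQ).
by rewrite /D mulmxBr CE' -!mulmxA (mulmxA _ (fourier Q l)) QQ mul1mx opprB addrA subrK.
Qed.

(** As [C = Q T] and [X(I,J) = Q_I T], the factor [T] cancels in [C X(I,J)^-1]. *)
Lemma fourier_cur_error (R : realType) n1 n2 r p (X : tensor R n1 n2 p)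
    (J : r.-tuple 'I_n2) (I : r.-tuple 'I_n1) (Q : tensor R n1 r p)
    (T : tensor R r r p) l :
  thin_tqr (tcols J X) Q T -> t_invertible (tsub I J X) ->
  fourier (X - tprod (tprod (tcols J X) (tinv (tsub I J X))) (trows I X)) l =
  fourier X l - fourier Q l *m
    (invmx (rowsub (tnth I) (fourier Q l)) *m rowsub (tnth I) (fourier X l)).
Proof.
case=> CE _ _ /(_ l); rewrite fourierB !fourier_tprod fourier_tinv CE fourier_tprod.
have -> : fourier (tsub I J X) l = rowsub (tnth I) (fourier Q l) *m fourier T l.
  by rewrite mul_rowsub_mx -fourier_tprod -CE !fourier_mxsub -mxsub_comp.
rewrite unitmx_mul => /andP[uQ uT]; rewrite invmxM // fourier_mxsub.
by rewrite !mulmxA mulmxK.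
Qed.

(** The average over [I] is bounded for fixed [J], then the one over [J]. Kept separate so that it
    also applies with all constants equal to 1. *)
Lemma tcur_expect_le (R : realType) (n1 n2 p r : nat) (p_gt0 : (0 < p)%N)
    (X : tensor R n1 n2 p) (V : tensor R n2 r p)
    (V_orth : tprod (ttr V) V = tid R r p)
    (Q : r.-tuple 'I_n2 -> tensor R n1 r p)
    (T : r.-tuple 'I_n2 -> tensor R r r p)
    (QT_qr : forall J : r.-tuple 'I_n2, 0 < arp_prob V J ->
       thin_tqr (tcols J X) (Q J) (T J))
    (X_inv : forall (J : r.-tuple 'I_n2) (I : r.-tuple 'I_n1),
       0 < tcur_prob V Q (J, I) -> t_invertible (tsub I J X))
    (eta theta : nat -> R)
    (eta_ge1 : forall k : nat, (1 <= k <= r)%N -> 1 <= eta k)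
    (theta_ge1 : forall k : nat, (1 <= k <= r)%N -> 1 <= theta k)
    (V_al : alignment_assumption V eta)
    (Q_al : forall J : r.-tuple 'I_n2, 0 < arp_prob V J ->
       alignment_assumption (Q J) theta) :
  expect (tcur_prob V Q) (fun JI => fnorm (X -
      tprod (tprod (tcols JI.1 X) (tinv (tsub JI.2 JI.1 X))) (trows JI.2 X)) ^+ 2) <=
  Gamma r theta * Gamma r eta * fnorm (X - tprod (tprod X V) (ttr V)) ^+ 2.
Proof.
have Gamma_ge0 : 0 <= Gamma r theta.
  rewrite /Gamma big_nat; apply: prodr_ge0 => k kr; rewrite ltnS in kr.
  by rewrite addr_ge0 // divr_ge0 // (le_trans ler01) // theta_ge1.
have p0 : 0 < (p%:R : R) by rewrite ltr0n.
(* Multiplying by [p], Parseval reduces both sides to a single frequency. *)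
rewrite -(ler_pM2l p0) mulrCA -fourier_parseval /expect mulr_sumr mulr_sumr.
under eq_bigr do rewrite mulrCA -fourier_parseval mulr_sumr.
rewrite exchange_big /=; apply: ler_sum => l _.
have [VF VR] := V_al.
(* The adjoint of [X] is interpolated at [J]; its projection error is the adjoint of
   [X - X V V^*]. *)
have := arp_interpolation_expect l ((fourier X l) ^t*) VR V_orth p_gt0 VF eta_ge1.
set U := fourier V l; set x := fourier X l.
have -> : frob2 (x ^t* - U *m U ^t* *m x ^t*) =
    frob2 (fourier (X - tprod (tprod X V) (ttr V)) l).
  rewrite fourierB !fourier_tprod fourier_ttr -[RHS]frob2_adj.
  by rewrite adjmxB !adjmxM trmxCK mulmxA.
move/(ler_wpM2l Gamma_ge0); rewrite mulrA; apply: le_trans.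
rewrite -(pair_bigA _ (fun J I => tcur_prob V Q (J, I) * frob2 (fourier (X -
  tprod (tprod (tcols J X) (tinv (tsub I J X))) (trows I X)) l))) /=.
rewrite mulr_sumr; apply: ler_sum => J _.
rewrite /tcur_prob /=; under eq_bigr do rewrite -mulrA.
rewrite -mulr_sumr mulrCA; have := arp_prob_ge0 V J.
rewrite le_eqVlt => /predU1P[<-|Jpos]; first by rewrite !mul0r.
rewrite ler_pM2l //; have qr := QT_qr J Jpos; have [_ Qo _] := qr.
have [QF QR] := Q_al J Jpos.
have xJ : (rowsub (tnth J) (x ^t*)) ^t* = colsub (tnth J) x.
  by apply/matrixP => i j; rewrite !mxE conjCK.
(* Taking adjoints turns the interpolant into [C N] with [N = (U_J^-1)^* U^*], an admissible choice
   in [frob2_tqr_proj_le]. *)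
rewrite -[X in Gamma _ _ * X]frob2_adj adjmxB trmxCK 2!adjmxM xJ -mulmxA.
apply: le_trans (ler_wpM2l Gamma_ge0 (frob2_tqr_proj_le l _ qr)).
apply: le_trans (arp_interpolation_expect l x QR Qo p_gt0 QF theta_ge1).
apply: ler_sum => I _; have := arp_prob_ge0 (Q J) I.
rewrite le_eqVlt => /predU1P[<-|Ipos]; first by rewrite !mul0r.
rewrite (fourier_cur_error l qr) //.
by apply: X_inv; exact: mulr_gt0.
Qed.

(** * The factor under perfect alignment, and the theorem *)

Lemma Gamma1 (R : realType) r : Gamma r (fun=> 1 : R) = r.+1%:R.
Proof.
have [->|r0] := posnP r; first by rewrite /Gamma big_geq.
(* In reversed order the factors are [(k+2)/(k+1)], and the product telescopes. *)
rewrite /Gamma big_add1 /= big_mkord (reindex_inj rev_ord_inj) /=.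
rewrite (eq_bigr (fun k : 'I_r => (k.+2)%:R / (k.+1)%:R)) => [|k _]; last first.
  have k0 : k.+1%:R != 0 :> R by rewrite pnatr_eq0.
  by rewrite subnSK // subKn 1?ltnW // addn1 -[X in X + _](divff k0) -mulrDl natr1.
rewrite -(big_mkord xpredT (fun k => (k.+2)%:R / (k.+1)%:R)) telescope_prodf //.
  by rewrite divr1.
by move=> k _; rewrite pnatr_eq0.
Qed.

Lemma eq_Gamma (R : realType) r (f g : nat -> R) :
  (forall k, (1 <= k <= r)%N -> f k = g k) -> Gamma r f = Gamma r g.
Proof. by move=> fg; apply: eq_big_nat => k kr; rewrite fg. Qed.

Theorem theorem4p13 (R : realType) (n1 n2 n3 r : nat)
    (n3_gt0 : (0 < n3)%N) (ler : (r <= minn n1 n2)%N)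
    (X : tensor R n1 n2 n3) (V : tensor R n2 r n3)
    (V_orth : tprod (ttr V) V = tid R r n3)
    (Q : r.-tuple 'I_n2 -> tensor R n1 r n3)
    (T : r.-tuple 'I_n2 -> tensor R r r n3)
    (QT_qr : forall J : r.-tuple 'I_n2, 0 < arp_prob V J ->
       thin_tqr (tcols J X) (Q J) (T J))
    (X_inv : forall (J : r.-tuple 'I_n2) (I : r.-tuple 'I_n1),
       0 < tcur_prob V Q (J, I) -> t_invertible (tsub I J X))
    (eta theta : nat -> R)
    (eta_ge1 : forall k : nat, (1 <= k <= r)%N -> 1 <= eta k)
    (theta_ge1 : forall k : nat, (1 <= k <= r)%N -> 1 <= theta k)
    (V_al : alignment_assumption V eta)
    (Q_al : forall J : r.-tuple 'I_n2, 0 < arp_prob V J ->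
       alignment_assumption (Q J) theta) :
  let err (JI : r.-tuple 'I_n2 * r.-tuple 'I_n1) : R :=
    fnorm (X - tprod (tprod (tcols JI.1 X) (tinv (tsub JI.2 JI.1 X)))
                     (trows JI.2 X)) ^+ 2 in
  let proj_err : R := fnorm (X - tprod (tprod X V) (ttr V)) ^+ 2 in
  [/\ expect (tcur_prob V Q) err <= Gamma r theta * Gamma r eta * proj_err,
      (forall k : nat, (1 <= k <= r)%N -> eta k = 1 /\ theta k = 1) ->
        Gamma r theta * Gamma r eta = (r.+1)%:R ^+ 2
    & (forall k : nat, (1 <= k <= r)%N -> perfectly_aligned V k) ->
      (forall J : r.-tuple 'I_n2, 0 < arp_prob V J ->
         forall k : nat, (1 <= k <= r)%N -> perfectly_aligned (Q J) k) ->
      [/\ alignment_assumption V (fun=> 1),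
          forall J : r.-tuple 'I_n2, 0 < arp_prob V J ->
            alignment_assumption (Q J) (fun=> 1)
        & expect (tcur_prob V Q) err <= (r.+1)%:R ^+ 2 * proj_err]].
Proof.
move=> err proj_err; split.
- refine (tcur_expect_le n3_gt0 V_orth QT_qr X_inv eta_ge1 theta_ge1 V_al Q_al).
- move=> h; rewrite (eq_Gamma (g := fun=> 1)) => [|k /h[]//].
  rewrite [Gamma r eta](eq_Gamma (g := fun=> 1)) => [|k /h[]//].
  by rewrite Gamma1 expr2.
- move=> V_pal Q_pal.
  (* Equality of the two distributions is alignment with constant 1; rank growth carries over
     unchanged. *)
  have al1 n (W : tensor R n r n3) f : alignment_assumption W f ->
      (forall k : nat, (1 <= k <= r)%N -> perfectly_aligned W k) ->
      alignment_assumption W (fun=> 1).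
    move=> [_ rkW] pW; split=> // k kr s pos l j _.
    by rewrite mul1r (pW k kr s pos l j).
  have V1 := al1 _ _ _ V_al V_pal.
  have Q1 (J : r.-tuple 'I_n2) (pos : 0 < arp_prob V J) :=
    al1 _ _ _ (Q_al J pos) (Q_pal J pos).
  split=> //; rewrite expr2 -Gamma1.
  refine (tcur_expect_le n3_gt0 V_orth QT_qr X_inv (fun _ _ => lexx _)
    (fun _ _ => lexx _) V1 Q1).
Qed.
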